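(* Fix $\delta\in(0,\pi/4)$. Let $h\in C^1(S^1,\mathbb{R})$ and $\eta>0$, and let $\varepsilon_0>0$, $N_0>0$, $\beta_0>0$ and the nonempty open set $\mathcal{I}\subset\mathbb{R}$ be such that for all $N>N_0$, $\beta>\beta_0$, $\sigma\in\mathcal{I}$, $0<\varepsilon\le\varepsilon_0$ the lifted coupled star network system has a normally attracting invariant manifold with boundary $M_\varepsilon$, $\mathcal{O}(\varepsilon)$-close to $M=M_+\times M_-$, on which $r^+>1-\eta$ and $r^-<\eta$ (such constants exist). Fix $N>N_0$, $\beta>\beta_0$, $\sigma\in\mathcal{I}$. (i) [General coupling] For arbitrary $h\in C^1$ there exist a nonempty open set $U_1\subset\mathbb{T}^N$ and constants $K>0$, $\varepsilon_1\in(0,\varepsilon_0]$ such that for every $0<\varepsilon\le\varepsilon_1$, every solution of the coupled system with initial condition on $M_\varepsilon$ whose $\theta$-component lies in $U_1$ stays in $M_\varepsilon$ for all $0\le t\le K/\varepsilon$. That is, chimera states exist for a time of order $1/\varepsilon$, uniformly for $\theta\in U_1$. (ii) [Kuramoto--Sakaguchi coupling] If in particular $h(\phi_1-\phi_2)=c_1\sin(\phi_1-\phi_2+\vartheta)$ with constants $c_1,\vartheta\in\mathbb{R}$, then there exist a nonempty open set $U_1\subset\mathbb{T}^N$ and constants $K>0$, $\varepsilon_1\in(0,\varepsilon_0]$ such that for every $0<\varepsilon\le\varepsilon_1$, every solution of the coupled system with initial condition on $M_\varepsilon$ whose $\theta$-component lies in $U_1$ stays in $M_\varepsilon$ for all $0\le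 t\le K/\varepsilon^2$, uniformly for $\theta\in U_1$.
   Context: Notation: $S^1=\mathbb{R}/2\pi\mathbb{Z}$, $\mathbb{T}^n=(S^1)^n$, $\mathbb{D}=\{w\in\mathbb{C}:|w|<1\}$. Coupled star network. For $N\in\mathbb{N}$ leaves per star, hub frequency $\beta>1$, $\sigma>0$, $\delta\in(0,\pi/4)$, $\varepsilon\ge0$ and $h:S^1\to\mathbb{R}$, the phases $\varphi_0^\pm$ (hubs) and $\varphi_i^\pm$ (leaves), $i=1,\dots,N$, in $S^1$ satisfy $$\dot\varphi_0^\pm=\beta+\beta\tfrac{\sigma}{N}\sum_{j=1}^N\sin(\varphi_j^\pm-\varphi_0^\pm+\delta),\qquad \dot\varphi_i^\pm=1+\sigma\sin(\varphi_0^\pm-\varphi_i^\pm+\delta)+\varepsilon\,h(\varphi_i^\pm-\varphi_i^\mp).$$ Relative phases are $\phi_i^\pm=\varphi_i^\pm-\varphi_0^\pm$, and $\Gamma=\varphi_0^+-\varphi_0^-$. The ''$+$'' star is described by $(\varphi_0^+,\phi_1^+,\dots,\phi_N^+)\in\mathbb{T}^{N+1}$. Lifted coordinates for the ''$-$'' star. Let $Q^-=S^1\times\mathbb{D}\times S^1\times\mathbb{T}^N\ni(\varphi_0^-,\alpha,\psi,\theta)$, with relative phases given by $e^{i\phi_j^-}=M_{\alpha,\psi}(e^{i\theta_j})$, where $M_{\alpha,\psi}(w)=\frac{\alpha+e^{i\psi}w}{1+\bar\alpha e^{i\psi}w}$. Put $z=z(\alpha,\psi,\theta)=\frac1N\sum_{j=1}^N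 M_{\alpha,\psi}(e^{i\theta_j})$, $f=\frac{-\sigma e^{-i\delta}}{2i}$, $g=1-\beta-\sigma\beta\,\frac{ze^{i\delta}-\bar z e^{-i\delta}}{2i}$. A lift of the coupled system is a system on $\mathbb{T}^{N+1}\times Q^-$ projecting onto the coupled system. Two kinds of lift can be applied to different parts of the vector field of $\phi^-$: a part of the form $\dot\phi_j=Fe^{i\phi_j}+G+\bar Fe^{-i\phi_j}$ with $F,G$ independent of $j$ (Watanabe--Strogatz lift) contributes $i(F\alpha^2+G\alpha+\bar F)$ to $\dot\alpha$, $F\alpha+G+\bar F\bar\alpha$ to $\dot\psi$ and $0$ to $\dot\theta$; a general part $\dot\phi_j=Y_j$ contributes $0$ to $\dot\alpha,\dot\psi$ and $\frac{|\alpha+e^{i(\psi+\theta_j)}|^2}{1-|\alpha|^2}Y_j$ to $\dot\theta_j$. The uncoupled ($\varepsilon=0$) part is always lifted by the Watanabe--Strogatz lift with $F=f$, $G=g$. In (i), the coupling term $Y_j=\varepsilon h(\phi_j^--\phi_j^+-\Gamma)$ is lifted by the second kind of lift. In (ii), the coupling term is split as $\varepsilon h(\phi_j^--\phi^C-\Gamma)$ (with $\phi^C$ the constant below), which is lifted by the Watanabe--Strogatz lift with $F=\varepsilon c_1 e^{i(\vartheta-\phi^C-\Gamma)}/(2i)$, $G=0$, plus the remainder, which is lifted by the second kind of lift; $M_\varepsilon$ is taken for this lift. Order parameters: $r^+=\bigl|\frac1N\sum_{j=1}^N e^{i\phi_j^+}\bigr|$ and $r^-=|z(\alpha,\psi,\theta)|$.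 A chimera state is a solution on $M_\varepsilon$. The manifolds $M_\pm$ (uncoupled, $\varepsilon=0$). $M_+=\{\phi_1^+=\dots=\phi_N^+=\phi^C,\ \varphi_0^+\in S^1\}$ with $$\phi^C=\delta-\pi+\arctan\Bigl(\frac{1+\beta\cos2\delta}{\beta\sin2\delta}\Bigr)+\arccos\Bigl(\frac{\beta-1}{\sigma\sqrt{1+\beta^2+2\beta\cos2\delta}}\Bigr).$$ $M_-=\{\alpha=\alpha^I+g^I(\psi,\theta),\ \psi\in S^1,\ \theta\in U,\ \varphi_0^-\in S^1\}$, where $\arg\alpha^I=-\frac\pi2+\delta$, $|\alpha^I|=\frac{\beta-1-\sqrt{(\beta-1)^2-\sigma^2(1+2\beta\cos2\delta)}}{\sigma(1+2\beta\cos2\delta)}$; $U\subset\mathbb{T}^N$ is an open neighborhood of the set $\Theta$ of uniformly distributed states (those $\theta$ for which there is $\varphi\in S^1$ with $\theta_j=\frac{2\pi j}{N}+\varphi$ up to permutation of indices); and $g^I$ is a $C^1$ function, $C^1$-small for $N$ large, for which $M_-$ is a normally attracting invariant manifold of the uncoupled ''$-$'' star. Normally attracting invariant manifold (NAIM). For a $C^1$ vector field with flow $\Phi^t$, a submanifold $M$ is a NAIM if: (1) $\Phi^t(M)=M$ for all $t$; (2) there is a continuous splitting of the ambient tangent bundle over $M$ as $TM\oplus \mathcal N$ with continuous projections, invariant under the tangent flow $T\Phi^t=T\Phi^t_M\oplus T\Phi^t_{\mathcal N}$; (3) there are $a<b\le0$ and $C>0$ with $\|T\Phi_M^t v\|\le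 Ce^{bt}\|v\|$ for $t\le0$, $v\in TM$, and $\|T\Phi_{\mathcal N}^t v\|\le Ce^{at}\|v\|$ for $t\ge0$, $v\in \mathcal N$. Conventions for $M_\varepsilon$. ''Boundary'' means topological boundary $\overline{M}\setminus M$, which lies over $\theta\in\partial U$. $M_\varepsilon$ being a NAIM with boundary of the coupled system means that it is a NAIM after the coupled vector field has been modified only in an arbitrarily small neighborhood over $\partial U$; away from this neighborhood the dynamics on $M_\varepsilon$ is that of the unmodified coupled system, so unmodified solutions can leave $M_\varepsilon$ only by $\theta$ crossing $\partial U$. ''$\mathcal{O}(\varepsilon)$-close to $M$'' means $$M_\varepsilon=\{\phi_i^+=\phi^C+\tilde g_i^C(\varphi_0^\pm,\psi,\theta),\ \alpha=\alpha^I+(g^I+\tilde g^I)(\varphi_0^\pm,\psi,\theta),\ \varphi_0^\pm,\psi\in S^1,\ \theta\in U\}$$ with $\|\tilde g^C\|_{C^1},\|\tilde g^I\|_{C^1}\in\mathcal{O}(\varepsilon)$. *)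

(* Defs.v *)
From HB Require Import structures.
From mathcomp Require Import all_boot all_order all_algebra.
From mathcomp Require Import all_classical all_reals all_analysis.
From mathcomp Require Import perm complex.
From mathcomp Require Import ring lra.

Set Implicit Arguments.
Unset Strict Implicit.
Unset Printing Implicit Defensive.

Import Order.TTheory GRing.Theory Num.Theory.
Import numFieldNormedType.Exports.

Local Open Scope classical_set_scope.
Local Open Scope ring_scope.

(** Conventions.  The circle S^1 = R / 2 pi Z is handled through its universal
    cover: an angle is a real number, a function on S^1 is a function on R that
    is invariant under 2 pi Z, a subset of T^N is a subset of R^N invariant
    under (2 pi Z)^N (it is open in T^N iff it is open in R^N), and a manifold
    or a flow is represented by its full preimage or its lift.  The disc D is
    the open unit disc of R * R, converted to R[i] inside formulas. *)

Section Angles.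
Context {R : realType}.

Definition eq_angle (a b : R) : Prop :=
  exists k : int, a = b + 2 * pi * k%:~R.

Definition eq_angles {N : nat} (u v : 'rV[R]_N) : Prop :=
  forall i, eq_angle (u 0 i) (v 0 i).

(** [invariant_set E A]: the set [A] is a union of classes of [E];
    [invariant_fun E f]: the function [f] is constant on the classes of [E]. *)
Definition invariant_set (T : Type) (E : T -> T -> Prop) (A : set T) : Prop :=
  forall x y, E x y -> A x -> A y.

Definition invariant_fun (T S : Type) (E : T -> T -> Prop) (f : T -> S) : Prop :=
  forall x y, E x y -> f x = f y.

End Angles.

Section Plane.
Context {R : realType}.

Definition toC (a : R * R) : R[i] := Complex a.1 a.2.
Definition ofC (z : R[i]) : R * R := (complex.Re z, complex.Im z).
Definition iC : R[i] := Complex 0 1.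
Definition RtoC (x : R) : R[i] := Complex x 0.
Definition cexp (t : R) : R[i] := Complex (cos t) (sin t).
Definition modC (z : R[i]) : R := ComplexField.Normc.normc z.

Definition moebius (a : R[i]) (psi : R) (w : R[i]) : R[i] :=
  (a + cexp psi * w) / (1 + conjc a * cexp psi * w).

(** With u = psi + theta_j and w = 1 + conj(a) e^(iu), which has positive real
    part when |a| < 1, the Moebius image of e^(i theta_j) is e^(iu) conj(w) / w,
    so that u - 2 arg w represents the relative phase phi_j^-. *)
Definition moebius_phase (a : R[i]) (u : R) : R :=
  let w := 1 + conjc a * cexp u in
  u - 2 * atan (complex.Im w / complex.Re w).

End Plane.

Section Manifolds.
Context {R : realType}.

(** [A] is meant to be open and [V] finite-dimensional: pointwise continuity of
    the differential is then continuity in operator norm. *)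
Definition C1_on (V W : normedModType R) (A : set V) (f : V -> W) : Prop :=
  forall x, A x -> differentiable f x /\
    forall v, {for x, continuous (fun y => 'd f y v)}.

(** The C^1 norm on [A] is the supremum of |g| and of its first partial
    derivatives, along the coordinate directions [dirs].  It is not replaced by
    an operator norm because the norm of ['rV[R]_N] is the sup norm, whose
    operator norm sums N partial derivatives and would change the meaning of
    "small for N large". *)
Definition C1_norm_le (V W : normedModType R) (dirs A : set V) (g : V -> W)
    (c : R) : Prop :=
  forall x, A x -> `|g x| <= c /\ forall v, dirs v -> `|'d g x v| <= c.

Definition flow_of (V : normedModType R) (Om : set V) (X : V -> V)
    (Phi : R -> V -> V) : Prop :=
  forall x, Om x -> Phi 0 x = x /\
    forall t : R, Om (Phi t x) /\
      is_derive t (1 : R) (Phi ^~ x) (X (Phi t x)).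

(** Velocities at [x] of curves in [M]: the tangent space when [M] is an
    embedded C^1 submanifold. *)
Definition tangent (V : normedModType R) (M : set V) (x : V) : set V :=
  [set v | exists c : R -> V, [/\ c 0 = x,
     \forall t \near (0 : R), M (c t) & is_derive (0 : R) (1 : R) c v]].

(** The splitting is given by the projections [P x] onto [tangent M x]; the
    normal space at [x] is the kernel of [P x].  In finite dimension, pointwise
    continuity of [x |-> P x v] is continuity of the projections.  The rates
    determine the splitting uniquely, so it needs no separate invariance
    under 2 pi Z when [M] and [X] have it. *)
Definition NAIM (V : normedModType R) (Om : set V) (X : V -> V) (M : set V)
    : Prop :=
  M `<=` Om /\ C1_on Om X /\
  exists Phi : R -> V -> V, flow_of Om X Phi /\
    (forall t, Phi t @` M = M) /\
    exists P : V -> V -> V,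
      [/\ forall x, M x -> linear (P x),
          forall x v, M x -> tangent M x (P x v),
          forall x v, M x -> tangent M x v -> P x v = v,
          forall v, {within M, continuous (P ^~ v)} &
          forall t x v, M x ->
            'd (Phi t) x (P x v) = P (Phi t x) ('d (Phi t) x v)] /\
      exists a b C : R, [/\ a < b, b <= 0, 0 < C,
        forall t x v, t <= 0 -> M x -> tangent M x v ->
          `|'d (Phi t) x v| <= C * expR (b * t) * `|v| &
        forall t x v, 0 <= t -> M x -> P x v = 0 ->
          `|'d (Phi t) x v| <= C * expR (a * t) * `|v|].

Definition solution_on (V : normedModType R) (Om : set V) (X : V -> V) (T : R)
    (x : R -> V) : Prop :=
  [/\ forall t, 0 <= t <= T -> Om (x t),
      {within `[0, T], continuous x} &
      forall t, 0 < t < T -> is_derive t (1 : R) x (X (x t))].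

End Manifolds.

(** (varphi_0^+, (phi_j^+)_j), relative phases *)
Notation plus_state R N := (R * 'rV[R]_N)%type
  (only parsing).
(** (varphi_0^-, (alpha, (psi, theta))) *)
Notation minus_state R N := (R * ((R * R) * (R * 'rV[R]_N)))%type
  (only parsing).
Notation star_state R N := (plus_state R N * minus_state R N)%type
  (only parsing).
(** ((varphi_0^+, varphi_0^-), (psi, theta)), the parameters of M_eps *)
Notation base_point R N := ((R * R) * (R * 'rV[R]_N))%type
  (only parsing).

Section Network.
Context {R : realType} {N : nat}.
Implicit Types (p : plus_state R N) (q : minus_state R N).
Implicit Types (x : star_state R N) (delta beta sigma eps : R).

Definition hub_p p : R := p.1.
Definition phi_p p (j : 'I_N) : R := p.2 0 j.

Definition hub_m q : R := q.1.
Definition alpha q : R * R := q.2.1.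
Definition psi q : R := q.2.2.1.
Definition theta q : 'rV[R]_N := q.2.2.2.
Definition phi_m q (j : 'I_N) : R :=
  moebius_phase (toC (alpha q)) (psi q + theta q 0 j).

Definition Gamma x : R := hub_p x.1 - hub_m x.2.
Definition theta_of x : 'rV[R]_N := theta x.2.
Definition base_of x : base_point R N :=
  ((hub_p x.1, hub_m x.2), (psi x.2, theta x.2)).

Definition Q_minus : set (minus_state R N) := [set q | modC (toC (alpha q)) < 1].
Definition phase_space : set (star_state R N) := [set x | Q_minus x.2].

Definition eq_base (b b' : base_point R N) : Prop :=
  [/\ eq_angle b.1.1 b'.1.1, eq_angle b.1.2 b'.1.2, eq_angle b.2.1 b'.2.1 &
      eq_angles b.2.2 b'.2.2].

Definition eq_state x y : Prop :=
  [/\ eq_angles x.1.2 y.1.2, alpha x.2 = alpha y.2 &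
      eq_base (base_of x) (base_of y)].

Definition z_mean q : R[i] :=
  (N%:R)^-1 * \sum_(j < N) moebius (toC (alpha q)) (psi q) (cexp (theta q 0 j)).

Definition r_plus x : R :=
  modC ((N%:R)^-1 * \sum_(j < N) cexp (phi_p x.1 j)).
Definition r_minus x : R := modC (z_mean x.2).

Definition f_WS delta sigma : R[i] :=
  - RtoC sigma * cexp (- delta) / (2 * iC).
Definition g_WS delta beta sigma q : R[i] :=
  1 - RtoC beta - RtoC (sigma * beta) *
    ((z_mean q * cexp delta - conjc (z_mean q) * cexp (- delta)) / (2 * iC)).

Definition hub_velocity delta beta sigma (phi : 'I_N -> R) : R :=
  beta + beta * (sigma / N%:R) * \sum_(j < N) sin (phi j + delta).

(** [Y i] is the coupling term of the i-th leaf. *)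
Definition plus_field delta beta sigma (Y : 'I_N -> R) p : plus_state R N :=
  let v0 := hub_velocity delta beta sigma (phi_p p) in
  (v0, \row_i (1 + sigma * sin (delta - phi_p p i) + Y i - v0)).

(** The lift of the uncoupled part (Watanabe--Strogatz with f, g), of a coupling
    part F e^(i phi_j) + conj(F) e^(-i phi_j) (Watanabe--Strogatz with F, 0) and
    of a coupling part [Y j] (general lift); [F'] and [G'] add up the two
    Watanabe--Strogatz parts.  The velocity of psi is a real element of R[i]. *)
Definition minus_field delta beta sigma (F : R[i]) (Y : 'I_N -> R) q
    : minus_state R N :=
  let a := toC (alpha q) in
  let F' := f_WS delta sigma + F in
  let G' := g_WS delta beta sigma q in
  (hub_velocity delta beta sigma (phi_m q),
   (ofC (iC * (F' * a ^+ 2 + G' * a + conjc F')),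
    (complex.Re (F' * a + G' + conjc F' * conjc a),
     \row_j (modC (a + cexp (psi q + theta q 0 j)) ^+ 2 / (1 - modC a ^+ 2)
             * Y j)))).

Definition uncoupled_minus_field delta beta sigma :
    minus_state R N -> minus_state R N :=
  minus_field delta beta sigma 0 (fun=> 0).

Definition coupling_p (h : R -> R) eps x (i : 'I_N) : R :=
  eps * h (phi_p x.1 i - phi_m x.2 i + Gamma x).
Definition coupling_m (h : R -> R) eps x (j : 'I_N) : R :=
  eps * h (phi_m x.2 j - phi_p x.1 j - Gamma x).

Definition phi_C delta beta sigma : R :=
  delta - pi
  + atan ((1 + beta * cos (2 * delta)) / (beta * sin (2 * delta)))
  + acos ((beta - 1) /
          (sigma * Num.sqrt (1 + beta ^+ 2 + 2 * beta * cos (2 * delta)))).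

Definition lift_general (h : R -> R) delta beta sigma eps x : star_state R N :=
  (plus_field delta beta sigma (coupling_p h eps x) x.1,
   minus_field delta beta sigma 0 (coupling_m h eps x) x.2).

Definition lift_KS (c1 vtheta : R) (h : R -> R) delta beta sigma eps x
    : star_state R N :=
  let pC := phi_C delta beta sigma in
  (plus_field delta beta sigma (coupling_p h eps x) x.1,
   minus_field delta beta sigma
     (RtoC (eps * c1) * cexp (vtheta - pC - Gamma x) / (2 * iC))
     (fun j => coupling_m h eps x j
               - eps * h (phi_m x.2 j - pC - Gamma x)) x.2).

Definition uniform_states : set 'rV[R]_N :=
  [set th | exists (s : {perm 'I_N}) (v : R), forall j : 'I_N,
     eq_angle (th 0 (s j)) (2 * pi * (j.+1)%:R / N%:R + v)].

Definition alpha_I delta beta sigma : R[i] :=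
  RtoC ((beta - 1 - Num.sqrt ((beta - 1) ^+ 2
                              - sigma ^+ 2 * (1 + 2 * beta * cos (2 * delta))))
        / (sigma * (1 + 2 * beta * cos (2 * delta))))
  * cexp (- (pi / 2) + delta).

Definition M_minus delta beta sigma (U : set 'rV[R]_N)
    (gI : R * 'rV[R]_N -> R * R) : set (minus_state R N) :=
  [set q | U (theta q) /\
    alpha q = ofC (alpha_I delta beta sigma) + gI (psi q, theta q)].

Definition M_eps delta beta sigma (U : set 'rV[R]_N)
    (gI : R * 'rV[R]_N -> R * R)
    (tC : base_point R N -> 'rV[R]_N) (tI : base_point R N -> R * R)
    : set (star_state R N) :=
  [set x | [/\ U (theta_of x),
     forall i, eq_angle (phi_p x.1 i)
                 (phi_C delta beta sigma + tC (base_of x) 0 i) &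
     alpha x.2 = ofC (alpha_I delta beta sigma)
                 + (gI (psi x.2, theta x.2) + tI (base_of x))]].

Definition dirs_minus : set (R * 'rV[R]_N) :=
  [set v | v = (1, 0) \/ exists j : 'I_N, v = (0, delta_mx 0 j)].
Definition dirs_base : set (base_point R N) :=
  [set v | v = ((1, 0), 0) \/ v = ((0, 1), 0) \/
     exists2 w, dirs_minus w & v = (0, w)].

Definition over_minus (U : set 'rV[R]_N) : set (R * 'rV[R]_N) :=
  [set b | U b.2].
Definition over_base (U : set 'rV[R]_N) : set (base_point R N) :=
  [set b | U b.2.2].

Definition eq_minus_base (b b' : R * 'rV[R]_N) : Prop :=
  eq_angle b.1 b'.1 /\ eq_angles b.2 b'.2.

(** For one value of (N, beta, sigma): the data of M_- and, for every eps, of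
    M_eps.  [nearU] is the neighbourhood of the boundary of [dom] over which the
    vector field may be modified. *)
Record chimera_data := ChimeraData {
  dom : set 'rV[R]_N;
  gI : R * 'rV[R]_N -> R * R;
  nearU : set 'rV[R]_N;
  tC : R -> base_point R N -> 'rV[R]_N;
  tI : R -> base_point R N -> R * R }.

Definition M_of delta beta sigma (d : chimera_data) eps :
    set (star_state R N) :=
  M_eps delta beta sigma (dom d) (gI d) (tC d eps) (tI d eps).

Definition is_M_minus delta beta sigma (U : set 'rV[R]_N)
    (g : R * 'rV[R]_N -> R * R) : Prop :=
  [/\ [/\ open U, invariant_set eq_angles U & uniform_states `<=` U],
      C1_on (over_minus U) g,
      invariant_fun eq_minus_base g &
      NAIM Q_minus (uncoupled_minus_field delta beta sigma)
           (M_minus delta beta sigma U g)].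

(** An open neighbourhood of the boundary of [U] that stays away from the
    uniformly distributed states, of which [U] is a neighbourhood. *)
Definition boundary_nbhd (U W : set 'rV[R]_N) : Prop :=
  [/\ open W, invariant_set eq_angles W, closure U `\` U `<=` W &
      closure W `&` uniform_states = set0].

(** [M] is a normally attracting invariant manifold with boundary of [X]:
    it is one without boundary after a modification of [X] over [W]. *)
Definition NAIM_with_boundary (W : set 'rV[R]_N)
    (X : star_state R N -> star_state R N) (M : set (star_state R N)) : Prop :=
  exists X' : star_state R N -> star_state R N,
    [/\ invariant_fun eq_state X',
        forall x, phase_space x -> ~ W (theta_of x) -> X' x = X x &
        NAIM phase_space X' M].

Definition O_eps (W : normedModType R) (U : set 'rV[R]_N)
    (t : R -> base_point R N -> W) : Prop :=
  exists2 C : R, 0 < C &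
    \forall e \near (0 : R)^'+, C1_norm_le dirs_base (over_base U) (t e) (C * e).

Definition has_chimeras delta beta sigma (eta eps0 : R)
    (X : R -> star_state R N -> star_state R N) (d : chimera_data) : Prop :=
  [/\ is_M_minus delta beta sigma (dom d) (gI d),
      boundary_nbhd (dom d) (nearU d),
      O_eps (dom d) (tC d) /\ O_eps (dom d) (tI d) &
      forall eps, 0 < eps <= eps0 ->
        [/\ C1_on (over_base (dom d)) (tC d eps) /\
              C1_on (over_base (dom d)) (tI d eps),
            invariant_fun eq_base (tC d eps) /\
              invariant_fun eq_base (tI d eps),
            NAIM_with_boundary (nearU d) (X eps) (M_of delta beta sigma d eps) &
            forall x, M_of delta beta sigma d eps x ->
              1 - eta < r_plus x /\ r_minus x < eta]].

(** A solution exists up to time [T], and every solution, also one given on a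
    shorter interval only, stays in [M]. *)
Definition stays_for (X : star_state R N -> star_state R N)
    (M : set (star_state R N)) (U1 : set 'rV[R]_N) (T : R) : Prop :=
  forall x0, M x0 -> U1 (theta_of x0) ->
    (exists s : R -> star_state R N,
       s 0 = x0 /\ solution_on phase_space X T s) /\
    (forall (S : R) (s : R -> star_state R N), S <= T ->
       s 0 = x0 -> solution_on phase_space X S s ->
       forall t, 0 <= t <= S -> M (s t)).

End Network.

Arguments chimera_data : clear implicits.

(** The standing hypothesis on the constants, for the family of lifted vector
    fields [X]; the last clause says that g^I is C^1-small for N large. *)
Definition chimera_family (R : realType) (delta eta eps0 : R) (N0 : nat)
    (beta0 : R) (I : set R)
    (X : forall N, R -> R -> R -> star_state R N -> star_state R N)
    (D : forall N, R -> R -> chimera_data R N) : Prop :=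
  (forall (N : nat) (beta sigma : R), (N0 < N)%N -> beta0 < beta -> 1 < beta ->
     I sigma -> 0 < sigma ->
     has_chimeras delta beta sigma eta eps0 (X N beta sigma) (D N beta sigma))
  /\
  (forall beta sigma kappa : R, beta0 < beta -> 1 < beta ->
     I sigma -> 0 < sigma -> 0 < kappa ->
     exists N1 : nat, forall N : nat, (N0 < N)%N -> (N1 <= N)%N ->
       C1_norm_le dirs_minus (over_minus (dom (D N beta sigma)))
         (gI (D N beta sigma)) kappa).

Section PhaseCheck.
Context {R : realType}.

Lemma cexpD (a b : R) : cexp (a + b) = cexp a * cexp b.
Proof. by rewrite /cexp cosD sinD; congr Complex; ring. Qed.

Lemma cexp_atan (p q : R) : 0 < p ->
  cexp (- (2 * atan (q / p))) * Complex p q = Complex p (- q).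
Proof.
move=> p_gt0; rewrite /cexp cosN sinN [2 * _]mulr_natl cos_mulr2n sin_mulr2n.
set y := atan _.
have y_cos : cos y != 0.
  by rewrite gt_eqF// cos_gt0_pihalf// atan_gtNpi2 atan_ltpi2.
have sE : sin y * p = q * cos y.
  have := atanK (q / p); rewrite /tan -/y => /(congr1 (fun r => r * cos y * p)).
  by rewrite divfK// => ->; rewrite mulrAC divfK ?gt_eqF.
have -> (a b c d : R) : Complex a b * Complex c d =
  Complex (a * c - b * d) (a * d + b * c) by [].
congr Complex.
  transitivity ((cos y ^+ 2 *+ 2 - 1) * p + sin y *+ 2 * (q * cos y)).
    by rewrite !mulr2n; ring.
  rewrite -sE (_ : _ + _ = (cos y ^+ 2 *+ 2 - 1) * p + sin y ^+ 2 * p *+ 2).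
    by rewrite sin2cos2 !mulr2n; ring.
  by rewrite !mulr2n; ring.
transitivity ((cos y ^+ 2 *+ 2 - 1) * q - cos y *+ 2 * (sin y * p)).
  by rewrite !mulr2n; ring.
rewrite sE !mulr2n; ring.
Qed.

Lemma moebius_phaseP (a : R[i]) (psi t : R) : modC a < 1 ->
  cexp (moebius_phase a (psi + t)) = moebius a psi (cexp t).
Proof.
case: a => a1 a2 a_lt1.
have {}a_lt1 : a1 ^+ 2 + a2 ^+ 2 < 1.
  rewrite ltNge; apply/negP => a_ge1; move: a_lt1; rewrite /modC /=.
  by rewrite ltNge -[X in X <= _]sqrtr1 ler_wsqrtr.
rewrite /moebius -mulrA -cexpD; move: (psi + t) => u.
rewrite /moebius_phase cexpD.
have -> : 1 + conjc (Complex a1 a2) * cexp u =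
    Complex (1 + (a1 * cos u + a2 * sin u)) (a1 * sin u - a2 * cos u).
  by rewrite /cexp; simpc; congr Complex; ring.
have p_gt0 : 0 < 1 + (a1 * cos u + a2 * sin u).
  have : (a1 * cos u + a2 * sin u) ^+ 2 <= a1 ^+ 2 + a2 ^+ 2.
    rewrite -[leRHS]mulr1 -(cos2Dsin2 u) -subr_ge0.
    have -> : (a1 ^+ 2 + a2 ^+ 2) * (cos u ^+ 2 + sin u ^+ 2) -
        (a1 * cos u + a2 * sin u) ^+ 2 = (a1 * sin u - a2 * cos u) ^+ 2 by ring.
    exact: sqr_ge0.
  move: (_ + _ * sin u) => m; nra.
rewrite /=; set p := 1 + _ in p_gt0 *; set q := _ - a2 * _.
have w_neq0 : Complex p q != 0 by rewrite eq_complex /= gt_eqF.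
apply: (mulIf w_neq0); rewrite divfK// -mulrA cexp_atan//.
rewrite /cexp /p /q; simpc; congr Complex.
  transitivity (a1 * (cos u ^+ 2 + sin u ^+ 2) + cos u); first by ring.
  by rewrite cos2Dsin2 mulr1.
transitivity (a2 * (cos u ^+ 2 + sin u ^+ 2) + sin u); first by ring.
by rewrite cos2Dsin2 mulr1.
Qed.

End PhaseCheck.

(* Main.v *)
Require Import Defs.
From HB Require Import structures.
From mathcomp Require Import all_boot all_order all_algebra.
From mathcomp Require Import all_classical all_reals all_analysis.
From mathcomp Require Import complex perm.
From mathcomp Require Import ring lra.

Set Implicit Arguments.
Unset Strict Implicit.
Unset Printing Implicit Defensive.

Import Order.TTheory GRing.Theory Num.Theory.
Import numFieldNormedType.Exports.

Local Open Scope classical_set_scope.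
Local Open Scope ring_scope.

(** On M_eps only theta can reach the boundary, and its velocity is the general
    lift of the remaining coupling: of order eps in (i), and of order eps^2 in
    (ii), where phi_j^+ is eps-close to phi^C and the Watanabe-Strogatz lift
    has absorbed the leading term.  The factor |alpha + e^(iu)|^2/(1-|alpha|^2)
    is bounded because |alpha| stays below some rho < 1 near a uniform state,
    so theta needs a time of order 1/eps (resp. 1/eps^2) to cross a ball around
    that state.  Over this ball the modified field, whose flow preserves M_eps,
    is the coupled field; uniqueness of solutions of a C^1 field does the
    rest. *)

(** * Continuous induction and the mean value inequality *)

(** The infimum of the counterexamples satisfies [P] by the closure step; the extension step then
    keeps every counterexample a positive distance to its right, which is absurd for an infimum. *)
Lemma real_induction (R : realType) (P : R -> Prop) (a b : R) :
  P a ->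
  (forall t, a <= t < b -> (forall s, a <= s <= t -> P s) ->
    exists2 d, 0 < d & forall s, t < s < t + d -> s <= b -> P s) ->
  (forall t, a < t <= b -> (forall s, a <= s < t -> P s) -> P t) ->
  forall t, a <= t <= b -> P t.
Proof.
move=> Pa ext clo t0 /andP[at0 t0b]; apply: contrapT => nPt0.
pose E := [set t | a <= t <= b /\ ~ P t].
have E0 : E !=set0 by exists t0; split => //; rewrite at0.
have Ea : lbound E a by move=> x [/andP[]].
have hE : has_inf E by split => //; exists a.
set tau := inf E.
have atau : a <= tau by exact: lb_le_inf.
have taut0 : tau <= t0.
  by apply: ge_inf; [exists a|split => //; rewrite at0].
have Pl s : a <= s < tau -> P s.
  move=> /andP[a_s st]; apply: contrapT => nPs.
  have : tau <= s.
    apply: ge_inf; [by exists a|split => //].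
    by rewrite a_s (le_trans (ltW st))// (le_trans taut0).
  by rewrite leNgt st.
have Ptau : P tau.
  have [<-//|ne] := eqVneq a tau.
  by apply: clo => //; rewrite lt_neqAle ne atau (le_trans taut0).
have taub : tau < b.
  rewrite lt_neqAle (le_trans taut0) // andbT; apply/eqP => tb.
  by apply: nPt0; rewrite (_ : t0 = tau)//; apply/eqP; rewrite eq_le taut0 tb
    t0b.
have [|s /andP[a_s]|d d0 Pd] := ext tau; first by rewrite atau.
  by rewrite le_eqVlt => /predU1P[->//|st]; apply: Pl; rewrite a_s.
have [e Ee elt] := inf_adherent d0 hE.
have [/andP[ae eb]] := Ee; apply.
have : tau <= e by apply: ge_inf => //; exists a.
rewrite le_eqVlt => /predU1P[<-//|te].
by apply: Pd => //; rewrite te.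
Qed.

Lemma within_segmentP (R : realType) (V : normedModType R) (f : R -> V)
    (a b t e : R) :
  {within `[a, b], continuous f} -> a <= t <= b -> 0 < e ->
  exists2 d, 0 < d &
    forall s, a <= s <= b -> `|s - t| < d -> `|f s - f t| < e.
Proof.
move=> /subspace_continuousP cf tab e0.
have /cf/cvgrPdist_lt/(_ e e0) : `[a, b]%classic t by rewrite /= in_itv.
rewrite near_withinE => /nbhs_ballP[d /= d0 H]; exists d => // s sab std.
rewrite distrC; apply: H; last by rewrite /= in_itv.
by rewrite /ball /= distrC.
Qed.

(** Values lie in a normed space, so continuous induction replaces an intermediate point. The slope
    slack [M + e] absorbs the error of the difference quotient; the additive [e] starts the
    induction at [a], where only continuity is known. *)
Lemma mean_value_inequality (R : realType) (V : normedModType R)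
    (f df : R -> V) (a b M : R) :
  a <= b ->
  {within `[a, b], continuous f} ->
  (forall t, a < t < b -> is_derive t (1 : R) f (df t)) ->
  (forall t, a < t < b -> `|df t| <= M) ->
  `|f b - f a| <= M * (b - a).
Proof.
rewrite le_eqVlt => /predU1P[->|ab] cf f' df_le.
  by rewrite !subrr normr0 mulr0.
have M0 : 0 <= M.
  by apply: le_trans (df_le ((a + b) / 2) _); rewrite ?midf_lt.
suff H e : 0 < e -> `|f b - f a| <= (M + e) * (b - a) + e.
  apply/ler_addgt0Pr => e e0.
  (* With slack [e / (b - a + 1)], the slope part and the additive part sum to exactly [e]. *)
  have c0 : 0 < b - a + 1 by rewrite addr_gt0// subr_gt0.
  apply: le_trans (H _ (divr_gt0 e0 c0)) _.
  rewrite mulrDl -addrA lerD2l -[X in _ + X]mulr1 -mulrDr divfK//.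
  by rewrite gt_eqF.
move=> e0; have Me : 0 <= M + e by rewrite addr_ge0// ltW.
pose P t := `|f t - f a| <= (M + e) * (t - a) + e.
apply: (@real_induction R P a b) (b) _; rewrite /P ?lexx ?(ltW ab)//.
- by rewrite !subrr normr0 mulr0 add0r ltW.
- move=> t /andP[+ tb] H; rewrite le_eqVlt => /predU1P[eat|a_t].
    have [|d d0 Hd] := @within_segmentP _ _ f a b a e cf _ e0.
      by rewrite lexx ltW.
    exists d => // s; rewrite -eat => /andP[a_s sd] sb.
    apply: ler_wpDl; first by rewrite mulr_ge0// subr_ge0 ltW.
    rewrite ltW// Hd// ?sb ?(ltW a_s)//.
    by rewrite gtr0_norm ?subr_gt0// ltrBlDl.
  have tab : a < t < b by rewrite a_t.
  have f't := f' _ tab.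
  have : derivable f t 1 by apply: ex_derive.
  rewrite /derivable -/(derive _ _ _) derive_val => /cvgrPdist_lt/(_ e e0).
  rewrite /dnbhs near_withinE => /nbhs_ballP[d /= d0 Hd].
  exists d => // s /andP[ts std] sb.
  have st0 : 0 < s - t by rewrite subr_gt0.
  have {Hd} := Hd (s - t); rewrite /ball /= sub0r normrN (gtr0_norm st0).
  rewrite ltrBlDl gt_eqF// => /(_ std isT).
  rewrite scaler1 subrK => Hd.
  have slope : `|(s - t)^-1 *: (f s - f t)| <= M + e.
    rewrite -[X in `|X|](subKr (df t)); apply: le_trans (ler_normB _ _) _.
    by rewrite lerD ?df_le// ltW.
  have fst : `|f s - f t| <= (M + e) * (s - t).
    rewrite -ler_pdivrMr// mulrC -[X in X * _](gtr0_norm) ?invr_gt0//.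
    by rewrite -normrZ.
  apply: le_trans (ler_distD (f t) _ _) _.
  have /(lerD fst) : `|f t - f a| <= (M + e) * (t - a) + e.
    by apply: H; rewrite lexx ltW.
  by rewrite addrA -mulrDr addrA subrK.
- move=> t /andP[a_t tb] H; apply/ler_addgt0Pr => n n0.
  have [|d d0 Hd] := @within_segmentP _ _ f a b t n cf _ n0.
    by rewrite tb ltW.
  pose s := Num.max a (t - d / 2).
  have st : s < t by rewrite gt_max a_t ltrBlDr ltrDl divr_gt0.
  have a_s : a <= s by rewrite le_max lexx.
  have {}Hd : `|f s - f t| < n.
    apply: Hd; first by rewrite a_s (le_trans (ltW st)).
    rewrite distrC gtr0_norm ?subr_gt0// ltrBlDl -ltrBlDr lt_max.
    by rewrite ltrD2l ltrN2 ltr_pdivrMr// ltr_pMr// ltr1n orbT.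
  apply: le_trans (ler_distD (f s) _ _) _.
  rewrite addrC; apply: lerD; last by rewrite distrC ltW.
  apply: le_trans (H s _) _; first by rewrite a_s.
  by rewrite lerD2r ler_wpM2l// lerD2r ltW.
Qed.

(** * Uniform boundedness in finite dimension and local Lipschitz bounds *)

Lemma linear_bundle (R : realType) (V W : normedModType R) (f : V -> W) :
  linear f -> exists g : {linear V -> W}, f =1 g.
Proof.
move=> lf; pose m := GRing.isLinear.Build R V W *:%R f lf.
by exists (HB.pack_for {linear V -> W} f m).
Qed.

(** The finite-dimensional uniform boundedness principle, as a property of V that
    passes to products: it turns the pointwise continuity of the differential in
    [C1_on] into a local Lipschitz bound. *)
Definition uniformly_bounding (R : realType) (V : normedModType R) : Prop :=
  forall (W : normedModType R) (T : Type) (F : set_system T) (A : T -> V -> W),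
    Filter F -> (forall t, linear (A t)) ->
    (forall v, exists C : R, \forall t \near F, `|A t v| <= C) ->
    exists C : R, \forall t \near F, forall v, `|A t v| <= C * `|v|.

Lemma uniformly_bounding_real (R : realType) : uniformly_bounding R.
Proof.
move=> W T F A FF linA /(_ 1)[C HC]; exists C.
apply: filterS HC => t H v.
have [g Ag] := linear_bundle (linA t).
have -> : A t v = v *: A t 1 by rewrite !Ag -linearZ /= -[in LHS](mulr1 v).
by rewrite normrZ mulrC ler_wpM2r.
Qed.

Lemma uniformly_bounding_prod (R : realType) (U V : normedModType R) :
  uniformly_bounding U -> uniformly_bounding V ->
  uniformly_bounding (U * V)%type.
Proof.
move=> bU bV W T F A FF linA Abnd.
have [||C1 H1] := bU W T F (fun t u => A t (u, 0)) FF.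
- move=> t a u v; rewrite -linA; congr (A t).
  by congr pair => /=; rewrite scaler0 addr0.
- by move=> v; apply: Abnd.
have [||C2 H2] := bV W T F (fun t u => A t (0, u)) FF.
- move=> t a u v; rewrite -linA; congr (A t).
  by congr pair => /=; rewrite scaler0 addr0.
- by move=> v; apply: Abnd.
(* [C1] and [C2] are not known to be nonnegative; absolute values allow the norms of [u] and [v] to
   be replaced by the max norm of the pair. *)
exists (`|C1| + `|C2|); apply: filterS2 H1 H2 => t H1 H2 [u v].
have -> : A t (u, v) = A t (u, 0) + A t (0, v).
  have [g Ag] := linear_bundle (linA t).
  by rewrite !Ag -linearD; congr (g (_, _)); rewrite /= ?addr0 ?add0r.
rewrite mulrDl; apply: le_trans (ler_normD _ _) _.
rewrite prod_normE /= lerD//.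
- apply: le_trans (H1 u) _.
  apply: le_trans (ler_wpM2r (normr_ge0 _) (ler_norm _)) _.
  by apply: ler_wpM2l => //; rewrite le_max lexx.
- apply: le_trans (H2 v) _.
  apply: le_trans (ler_wpM2r (normr_ge0 _) (ler_norm _)) _.
  by apply: ler_wpM2l => //; rewrite le_max lexx orbT.
Qed.

(** The bounds on the finitely many basis vectors hold on one common filter set, and each coordinate
    is at most the sup norm, so their sum bounds the operator. *)
Lemma uniformly_bounding_rV (R : realType) (n : nat) :
  uniformly_bounding 'rV[R]_n.
Proof.
move=> W T F A FF linA Abnd.
have [C HC] := choice (fun i : 'I_n => Abnd (delta_mx 0 i)).
exists (\sum_i `|C i|); have := filter_forall FF HC.
apply: filterS => t H v.
have [g Ag] := linear_bundle (linA t).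
rewrite Ag {1}[v]row_sum_delta linear_sum mulr_suml.
apply: le_trans (ler_norm_sum _ _ _) (ler_sum _ _) => i _.
rewrite linearZ normrZ mulrC -Ag.
apply: le_trans (ler_wpM2r (normr_ge0 _) (H i)) _.
apply: le_trans (ler_wpM2r (normr_ge0 _) (ler_norm _)) _.
apply: ler_wpM2l => //.
by rewrite [leRHS]mx_normrE; apply: (le_bigmax _ _ (0, i)).
Qed.

Definition lipschitz_near (R : realType) (V W : normedModType R)
    (X : V -> W) (x : V) : Prop :=
  exists L d : R, 0 < d /\ forall y z, `|y - x| < d -> `|z - x| < d ->
    `|X y - X z| <= L * `|y - z|.

(** Uniform boundedness gives one operator bound [C] for the differentials on a ball around [x]; the
    mean value inequality along the segment from [z] to [y] makes [C] a Lipschitz constant. *)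
Lemma C1_lipschitz_near (R : realType) (V W : normedModType R) (A : set V)
    (X : V -> W) (x : V) :
  uniformly_bounding V -> C1_on A X -> nbhs x A -> lipschitz_near X x.
Proof.
move=> bV X1 xA; have Ax := nbhs_singleton xA.
have [||C HC] := bV W V (nbhs x) (fun y => 'd X y) _.
- by move=> t; apply: linearP.
- move=> v; exists (`|'d X x v| + 1).
  have /cvgrPdist_lt/(_ 1 ltr01) := (X1 x Ax).2 v.
  apply: filterS => y; rewrite distrC => H.
  rewrite -(subrK ('d X x v) ('d X y v)) (le_trans (ler_normD _ _))//.
  by rewrite addrC lerD2l ltW.
have : nbhs x (A `&` [set y | forall v, `|'d X y v| <= C * `|v| ]).
  exact: filterI.
move=> /nbhs_ballP[d /= d0 Hd].
exists C, d; split => // y z yd zd.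
pose g (t : R) : V := z + t *: (y - z).
have gd (t : R) : 0 <= t <= 1 -> ball x d (g t).
  move=> /andP[t0 t1]; rewrite -ball_normE /ball_ /=.
  have -> : x - g t = (1 - t) *: (x - z) + t *: (x - y).
    have -> : x - y = (x - z) - (y - z) by rewrite opprB addrA subrK.
    rewrite scalerBl scale1r [t *: (_ - (y - z))]scalerBr addrA subrK.
    by rewrite opprD addrA.
  apply: le_lt_trans (ler_normD _ _) _.
  rewrite !normrZ (ger0_norm t0) ger0_norm ?subr_ge0//.
  rewrite (distrC x z) (distrC x y).
  have tz : (1 - t) * `|z - x| <= (1 - t) * d.
    by apply: ler_wpM2l; [rewrite subr_ge0|exact: ltW].
  (* For [t] nonzero the [y] term supplies the strict inequality; at [t = 0] it vanishes and [z]
     itself must be used. *)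
  have [->|tn0] := eqVneq t 0; first by rewrite subr0 mul1r mul0r addr0.
  have ty : t * `|y - x| < t * d by rewrite ltr_pM2l// lt_neqAle eq_sym tn0.
  lra.
have g' (t : R) : is_diff t g (0 + *:%R ^~ (y - z)).
  have -> : g = cst z + *:%R ^~ (y - z) by apply/funext.
  exact: is_diffD.
have Xg' (t : R) : 0 <= t <= 1 ->
    is_derive t (1 : R) (X \o g) ('d X (g t) (y - z)).
  move=> /gd/Hd[/X1[dX _] _].
  have dXg : is_diff t (X \o g) ('d X (g t) \o (0 + *:%R ^~ (y - z))).
    exact: is_diff_comp.
  apply: DeriveDef; first exact/diff_derivable/ex_diff.
  by rewrite deriveE ?diff_val//= add0r scale1r.
have -> : X y - X z = (X \o g) 1 - (X \o g) 0.
  by rewrite /= /g scale1r scale0r addr0 (addrC z) subrK.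
have -> : C * `|y - z| = C * `|y - z| * (1 - 0) by rewrite subr0 mulr1.
apply: (@mean_value_inequality _ _ _ (fun t => 'd X (g t) (y - z))) => //.
- apply: derivable_within_continuous => t; rewrite in_itv /= => /Xg' H.
  exact: ex_derive.
- by move=> t /andP[t0 t1]; apply: Xg'; rewrite !ltW.
- move=> t /andP[t0 t1]; have /gd/Hd[_] : 0 <= t <= 1 by rewrite !ltW.
  exact.
Qed.

(** * Uniqueness of solutions and confinement by slow drift *)

(** Just after a time of agreement, the maximum of the norm of [s - f] on a short interval is, by
    the Lipschitz bound and the mean value inequality, at most itself times a factor below 1, so it
    is zero. Continuous induction spreads the agreement over the whole segment. *)
Lemma ode_unique (R : realType) (V : normedModType R) (X : V -> V)
    (s f : R -> V) (b : R) :
  (forall t, 0 <= t < b -> lipschitz_near X (f t)) ->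
  {within `[0, b], continuous s} -> {within `[0, b], continuous f} ->
  (forall t, 0 < t < b -> is_derive t (1 : R) s (X (s t))) ->
  (forall t, 0 < t < b -> is_derive t (1 : R) f (X (f t))) ->
  s 0 = f 0 -> forall t, 0 <= t <= b -> s t = f t.
Proof.
move=> lipX cs cf s' f' sf0.
apply: real_induction => // t.
- move=> /[dup] /lipX[L [d [d0 Xd]]] /andP[t0 tb] /(_ t) sft.
  have {}sft : s t = f t by apply: sft; rewrite t0 lexx.
  have tI : 0 <= t <= b by rewrite t0 ltW.
  have [ds ds0 Hs] := within_segmentP cs tI d0.
  have [df df0 Hf] := within_segmentP cf tI d0.
  have L0 : 0 < `|L| + 1 by rewrite ltr_wpDl.
  (* [ds] and [df] keep both curves in the Lipschitz ball; the last bound makes the factor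
     [|L| * (c - t)] less than 1. *)
  exists (Num.min (Num.min ds df) (`|L| + 1)^-1).
    by rewrite !lt_min ds0 df0 invr_gt0.
  move=> r /andP[tr]; rewrite -ltrBlDl !lt_min -andbA => /and3P[rs rf rL] rb.
  pose u x := s x - f x.
  have sub : `[t, r]%classic `<=` `[0, b]%classic.
    move=> x; rewrite /= !in_itv /= => /andP[tx xr].
    by rewrite (le_trans t0)// (le_trans xr).
  have cu : {within `[t, r], continuous u}.
    apply: continuous_subspaceW sub _ => x.
    by apply: continuousB; [apply: cs|apply: cf].
  have cnu : {within `[t, r], continuous (fun x => `|u x|)}.
    by move=> x; apply: (cvg_comp _ _ (cu x) (@norm_continuous _ V (u x))).
  have [c /[!in_itv]/= /andP[tc cr] umax] := EVT_max (ltW tr) cnu.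
  have uc0 : `|u c - u t| <= `|L| * `|u c| * (c - t).
    apply: (@mean_value_inequality _ _ _ (fun x => X (s x) - X (f x))) => //.
    - apply: continuous_subspaceW cu => x.
      by rewrite /= !in_itv /= => /andP[-> xc]; rewrite (le_trans xc).
    - move=> x /andP[tx xc]; have xb : 0 < x < b.
        by rewrite (le_lt_trans t0 tx) (lt_le_trans xc)// (le_trans cr).
      by apply: is_deriveB; [apply: s'|apply: f'].
    - move=> x /andP[tx xc].
      have xI : 0 <= x <= b.
        by rewrite (le_trans t0 (ltW tx)) (le_trans (ltW xc))// (le_trans cr).
      have xt : `|x - t| <= r - t.
        by rewrite gtr0_norm ?subr_gt0// lerD2r (le_trans (ltW xc)).
      apply: le_trans (Xd _ _ _ _) _.
      - by rewrite -sft Hs// (le_lt_trans xt).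
      - by rewrite Hf// (le_lt_trans xt).
      have := umax x; rewrite in_itv /= (ltW tx) (le_trans (ltW xc))//.
      move=> /(_ isT) ux.
      apply: le_trans (ler_wpM2r (normr_ge0 _) (ler_norm L)) _.
      exact: ler_wpM2l.
  have {}uc0 : `|u c| <= 0.
    move: uc0; rewrite {2}/u sft subrr subr0 mulrAC => uc0.
    have rL1 : (`|L| + 1) * (c - t) < 1.
      by rewrite mulrC -ltr_pdivlMr// mul1r (le_lt_trans _ rL)// lerD2r.
    rewrite leNgt; apply/negP => ucgt0.
    have : `|L| * (c - t) * `|u c| < 1 * `|u c|.
      rewrite ltr_pM2r//; have : 0 <= c - t by rewrite subr_ge0.
      lra.
    by rewrite mul1r ltNge uc0.
  have /umax/le_trans/(_ uc0) : r \in `[t, r] by rewrite in_itv /= lexx ltW.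
  by rewrite normr_le0 subr_eq0 => /eqP.
- move=> /andP[t0 tb] H; apply/eqP; rewrite -subr_eq0 -normr_le0.
  apply/ler_addgt0Pr => e e0; rewrite add0r.
  have tI : 0 <= t <= b by rewrite tb ltW.
  have e2 : 0 < e / 2 by rewrite divr_gt0.
  have [ds ds0 Hs] := within_segmentP cs tI e2.
  have [df df0 Hf] := within_segmentP cf tI e2.
  (* A time just before [t], at which the curves agree and each is within [e / 2] of its value at
     [t]. *)
  pose r := Num.max 0 (t - Num.min ds df / 2).
  have rt : r < t by rewrite gt_max t0 ltrBlDr ltrDl divr_gt0// lt_min ds0.
  have r0 : 0 <= r by rewrite le_max lexx.
  have rI : 0 <= r <= b by rewrite r0 (le_trans (ltW rt)).
  have : `|r - t| < Num.min ds df.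
    rewrite distrC gtr0_norm ?subr_gt0// ltrBlDl -ltrBlDr lt_max.
    by rewrite ltrD2l ltrN2 ltr_pdivrMr// ltr_pMr ?ltr1n ?orbT// lt_min ds0.
  rewrite lt_min => /andP[/(Hs _ rI) + /(Hf _ rI)].
  rewrite H ?r0// => es ef.
  rewrite (le_trans (ler_distD (f r) _ _))// [leRHS]splitr.
  by rewrite distrC lerD ?ltW.
Qed.

Lemma is_derive_snd (R : realType) (U V : normedModType R)
    (f : R -> (U * V)%type) (t : R) (v : U * V) :
  is_derive t (1 : R) f v -> is_derive t (1 : R) (snd \o f) v.2.
Proof.
move=> [df dfE].
have H : (fun h => h^-1 *: ((snd \o f) (h *: 1 + t) - (snd \o f) t)) @ 0^'
    --> v.2.
  move: df; rewrite /derivable -/(derive _ _ _) dfE => df.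
  exact: (cvg_comp _ _ df (@cvg_snd _ _ _ _ _)).
by apply: DeriveDef; [apply/cvg_ex; exists v.2|exact: cvg_lim].
Qed.

(** The speed bound is available only inside the ball, so this is a bootstrap: while the curve is
    inside, its displacement is at most [L * T < r], and this strict gap prevents it from reaching
    the sphere. *)
Lemma drift_barrier (R : realType) (V : normedModType R) (f df : R -> V)
    (T L r : R) :
  0 < r -> L * T < r ->
  (forall t, 0 <= t <= T -> is_derive t (1 : R) f (df t)) ->
  (forall t, 0 <= t <= T -> `|f t - f 0| < r -> `|df t| <= L) ->
  forall t, 0 <= t <= T -> `|f t - f 0| < r.
Proof.
move=> r0 LT f' df_le.
have cf t : 0 <= t <= T -> {within `[0, t], continuous f}.
  move=> /andP[t0 tT]; apply: derivable_within_continuous => s.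
  rewrite in_itv /= => /andP[s0 st]; have f's : is_derive s (1 : R) f (df s).
    by apply: f'; rewrite s0 (le_trans st).
  exact: ex_derive.
apply: real_induction.
- by rewrite subrr normr0.
- move=> t /andP[t0 tT] H.
  have gap : 0 < r - `|f t - f 0| by rewrite subr_gt0 H// t0 lexx.
  have TT : 0 <= T <= T by rewrite lexx (le_trans t0 (ltW tT)).
  have tI : 0 <= t <= T by rewrite t0 ltW.
  have [d d0 Hd] := within_segmentP (cf _ TT) tI gap.
  exists d => // s /andP[ts sd] sT.
  rewrite (le_lt_trans (ler_distD (f t) _ _))// -ltrBrDr Hd//.
    by rewrite sT (le_trans t0 (ltW ts)).
  by rewrite gtr0_norm ?subr_gt0// ltrBlDl.
- move=> t /andP[t0 tT] H.
  (* The speed bound at time 0 forces [L] to be nonnegative, so that [L * t] is at most [L * T]. *)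
  have L0 : 0 <= L.
    apply: le_trans (normr_ge0 _) (df_le 0 _ _).
      by rewrite lexx (le_trans (ltW t0)).
    by rewrite subrr normr0.
  apply: le_lt_trans LT.
  apply: le_trans (mean_value_inequality (df := df) (M := L) (ltW t0) _ _ _) _.
  - by apply: cf; rewrite ltW.
  - by move=> s /andP[s0 st]; apply: f'; rewrite ltW// (le_trans (ltW st)).
  - move=> s /andP[s0 st]; apply: df_le; last by apply: H; rewrite ltW.
    by rewrite ltW// (le_trans (ltW st)).
  - by rewrite subr0 ler_wpM2l.
Qed.

(** Transfers the Lipschitz bound from the modified field, which is C^1 by the definition of a NAIM,
    to the coupled field where the two agree. *)
Lemma lipschitz_near_eq (R : realType) (V W : normedModType R)
    (X Y : V -> W) (x : V) :
  lipschitz_near Y x -> (\forall y \near x, X y = Y y) -> lipschitz_near X x.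
Proof.
move=> [L [d [d0 H]]] /nbhs_normP[e /= e0 He].
exists L, (Num.min d e); split; first by rewrite lt_min d0.
move=> y z; rewrite !lt_min => /andP[yd ye] /andP[zd ze].
by rewrite !He /= ?H// distrC.
Qed.

(** * The phase space and solutions that stay in the manifold *)

Lemma modC_continuous (R : realType) :
  continuous (fun a : R * R => modC (toC a)).
Proof.
move=> a; rewrite /modC /toC /=.
apply: (@continuous_comp _ _ _ (fun a : R * R => a.1 ^+ 2 + a.2 ^+ 2) Num.sqrt).
  apply: continuousD; apply: (continuous_comp _ (@exprn_continuous _ 2 _)).
    exact: cvg_fst.
  exact: cvg_snd.
exact: sqrt_continuous.
Qed.

Lemma phase_space_open (R : realType) (N : nat) (x : star_state R N) :
  phase_space x -> nbhs x (@phase_space R N).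
Proof.
move=> x1.
have c : {for x, continuous (fun x : star_state R N => modC (toC (alpha x.2)))}.
  apply: (@continuous_comp _ _ _ (fun x : star_state R N => x.2.2.1)
    (fun a : R * R => modC (toC a))); last exact: modC_continuous.
  apply: (@continuous_comp _ _ _ (fun x : star_state R N => x.2.2) fst).
    apply: (@continuous_comp _ _ _ (fun x : star_state R N => x.2) snd).
      exact: cvg_snd.
    exact: cvg_snd.
  exact: cvg_fst.
exact: (cvgr_lt _ c 1 x1).
Qed.

Lemma theta_of_continuous (R : realType) (N : nat) :
  continuous (@theta_of R N).
Proof.
move=> x.
apply: (@continuous_comp _ _ _ (fun x : star_state R N => x.2.2.2) snd).
  apply: (@continuous_comp _ _ _ (fun x : star_state R N => x.2.2) snd).
    apply: (@continuous_comp _ _ _ (fun x : star_state R N => x.2) snd).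
      exact: cvg_snd.
    exact: cvg_snd.
  exact: cvg_snd.
exact: cvg_snd.
Qed.

Lemma uniformly_bounding_star (R : realType) (N : nat) :
  uniformly_bounding (star_state R N).
Proof.
do ?[apply: uniformly_bounding_prod]; solve
  [exact: uniformly_bounding_real | exact: uniformly_bounding_rV].
Qed.

(** The flow of [X'] preserves [M], and its theta component moves with speed at most [L] over [B].
    The barrier therefore keeps the orbit over [B] up to time [T], where it also solves [X];
    uniqueness identifies every solution of [X] with it. *)
Lemma stays_for_of_slow_drift (R : realType) (N : nat)
    (X X' : star_state R N -> star_state R N) (M : set (star_state R N))
    (B U1 : set 'rV[R]_N) (r L T : R) :
  NAIM phase_space X' M ->
  (forall x, phase_space x -> B (theta_of x) -> X' x = X x) ->
  (forall th th', U1 th -> `|th' - th| < r -> B th') ->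
  (forall x, M x -> B (theta_of x) -> `|theta_of (X x)| <= L) ->
  0 < r -> L * T < r ->
  stays_for X M U1 T.
Proof.
move=> [MQ [X'1 [Phi [flow [PhiM _]]]]] XX' U1B slow r0 LT x0 Mx0 U1x0.
have [Phi0 Phi'] := flow x0 (MQ _ Mx0).
have PM t : M (Phi t x0) by rewrite -(PhiM t); exists x0.
have Pth t : is_derive t (1 : R) (theta_of \o Phi ^~ x0)
    (theta_of (X' (Phi t x0))).
  have [_] := Phi' t.
  (* Theta is the last component of the nested pairs, four second projections deep. *)
  by move=> /is_derive_snd/is_derive_snd/is_derive_snd/is_derive_snd.
have PB t : 0 <= t <= T -> `|theta_of (Phi t x0) - theta_of x0| < r.
  move=> tT; rewrite -[in theta_of x0]Phi0.
  apply: (drift_barrier (f := theta_of \o Phi ^~ x0) r0 LT) tT => //.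
  move=> s sT /=; rewrite Phi0 => /(U1B _ _ U1x0) Bs.
  by rewrite XX' ?slow//; apply: MQ.
have P'X t : 0 <= t <= T -> is_derive t (1 : R) (Phi ^~ x0) (X (Phi t x0)).
  move=> /PB/(U1B _ _ U1x0) Bt; have [Qt] := Phi' t.
  by rewrite XX'.
have cP a : {within `[0, a], continuous (Phi ^~ x0)}.
  by apply: derivable_within_continuous => t _; have [_ []] := Phi' t.
split.
  exists (Phi ^~ x0); split => //; split=> // t.
    by have [] := Phi' t.
  by move=> /andP[t0 tT]; apply: P'X; rewrite !ltW.
move=> S s ST s0 [Qs cs s' t tS].
suff -> : s t = Phi t x0 by [].
apply: (ode_unique (X := X) (f := Phi ^~ x0) (b := S)) tS => //;
  last by rewrite s0.
- move=> u /andP[u0 uS].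
  have uT : 0 <= u <= T by rewrite u0 (le_trans (ltW uS)).
  have [Qu _] := Phi' u.
  apply: lipschitz_near_eq (C1_lipschitz_near (@uniformly_bounding_star R N)
    X'1 (phase_space_open Qu)) _.
  (* The barrier inequality is strict, so it persists near the orbit point and the two fields agree
     on a whole neighbourhood. *)
  have nr : \forall y \near Phi u x0, `|theta_of y - theta_of x0| < r.
    have := PB _ uT; rewrite -subr_gt0 => gap.
    have /cvgrPdist_lt/(_ _ gap) := @theta_of_continuous R N (Phi u x0).
    apply: filterS => y yP.
    rewrite (le_lt_trans (ler_distD (theta_of (Phi u x0)) _ _))//.
    by rewrite -ltrBrDr distrC.
  apply: filterS2 (phase_space_open Qu) nr => y Qy /(U1B _ _ U1x0) By.
  by rewrite XX'.
- by move=> u /andP[u0 uS]; apply: P'X; rewrite ltW// (le_trans (ltW uS)).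
Qed.

(** * Angles, norms and the weight of the general lift *)

Lemma eq_angle_refl (R : realType) (a : R) : eq_angle a a.
Proof. by exists 0; rewrite mulr0 addr0. Qed.

Lemma eq_angle_sym (R : realType) (a b : R) : eq_angle a b -> eq_angle b a.
Proof. by move=> [k ->]; exists (- k); rewrite rmorphN /= mulrN addrK. Qed.

Lemma eq_angle_trans (R : realType) (a b c : R) :
  eq_angle a b -> eq_angle b c -> eq_angle a c.
Proof.
by move=> [k ->] [l ->]; exists (l + k); rewrite intrD (mulrDr (2 * pi)) addrA.
Qed.

Lemma eq_angle_segment (R : realType) (a : R) :
  exists2 b, eq_angle a b & 0 <= b <= 2 * pi.
Proof.
have p0 : 0 < 2 * pi :> R by rewrite mulr_gt0// pi_gt0.
exists (a - 2 * pi * (Num.floor (a / (2 * pi)))%:~R).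
  by exists (Num.floor (a / (2 * pi))); rewrite subrK.
have /andP[lo hi] := floor_itv (a / (2 * pi)).
rewrite subr_ge0 lerBlDr mulrC -ler_pdivlMr// lo /=.
rewrite -[X in _ <= X + _]mul1r -mulrDl -ler_pdivrMr// addrC.
by rewrite ltW// (lt_le_trans hi)// intrD.
Qed.

Lemma row_coord_le (R : realType) (n : nat) (v : 'rV[R]_n) (i : 'I_n) :
  `|v 0 i| <= `|v|.
Proof. by rewrite [leRHS]mx_normrE; apply: (le_bigmax _ _ (0, i)). Qed.

Lemma row_norm_le (R : realType) (n : nat) (v : 'rV[R]_n) (c : R) :
  0 <= c -> (forall i, `|v 0 i| <= c) -> `|v| <= c.
Proof.
move=> c0 H; rewrite [leLHS]mx_normrE; apply: bigmax_le => //= -[i j] _ /=.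
by rewrite (ord1 i).
Qed.

Lemma modC_ge0 (R : realType) (z : R[i]) : 0 <= modC z.
Proof. by case: z => x y; rewrite /modC /= sqrtr_ge0. Qed.

(** The norm of [R * R] is the max norm; the factor 2 generously covers the square root of 2
    relating it to the modulus. *)
Lemma modC_toCD (R : realType) (a b : R * R) :
  modC (toC (a + b)) <= modC (toC a) + 2 * `|b|.
Proof.
apply: le_trans (le_normcD (toC a) (toC b)) _.
rewrite lerD2l /= -[leRHS]ger0_norm ?mulr_ge0// -sqrtr_sqr ler_wsqrtr//.
have b1 : `|b.1| <= `|b| by rewrite [leRHS]prod_normE le_max lexx.
have b2 : `|b.2| <= `|b| by rewrite [leRHS]prod_normE le_max lexx orbT.
have := normr_ge0 b.1; have := normr_ge0 b.2.
rewrite -(real_normK (num_real b.1)) -(real_normK (num_real b.2)); nra.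
Qed.

Lemma modC_cexp (R : realType) (t : R) : modC (cexp t) = 1.
Proof. by rewrite /modC /= cos2Dsin2 sqrtr1. Qed.

(** The modulus in the numerator is at most [rho + 1 < 2], and the denominator is at least
    [1 - rho ^+ 2]. *)
Lemma lift_weight_bound (R : realType) (a : R[i]) (u rho : R) :
  modC a <= rho -> rho < 1 ->
  0 <= modC (a + cexp u) ^+ 2 / (1 - modC a ^+ 2) <= 4 / (1 - rho ^+ 2).
Proof.
move=> a_rho rho1; have a0 := modC_ge0 a.
have rho2 : rho ^+ 2 < 1 by rewrite expr_lt1// (le_trans a0).
have a2 : modC a ^+ 2 <= rho ^+ 2 by rewrite lerXn2r// nnegrE// (le_trans a0).
have num : modC (a + cexp u) <= 2.
  apply: le_trans (le_normcD _ _) _.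
  by rewrite -!/(modC _) modC_cexp; lra.
have num2 : modC (a + cexp u) ^+ 2 <= 4.
  by have := modC_ge0 (a + cexp u); nra.
have den : 0 < 1 - rho ^+ 2 by lra.
rewrite divr_ge0 ?sqr_ge0//=; last lra.
apply: ler_pM => //; first exact: sqr_ge0.
  by rewrite invr_ge0; lra.
by rewrite lef_pV2 ?posrE; lra.
Qed.

Lemma ler_sinB (R : realType) (a b : R) : `|sin a - sin b| <= `|a - b|.
Proof.
wlog ba : a b / b <= a.
  by move=> H; have [/H//|/ltW/H] := leP b a; rewrite distrC [leRHS]distrC.
rewrite [leRHS]ger0_norm ?subr_ge0// -[leRHS]mul1r.
apply: (mean_value_inequality (df := cos)) => //.
- by apply: derivable_within_continuous => t _; apply: ex_derive.
- by move=> t _; rewrite ler_norml cos_geN1 cos_le1.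
Qed.

Lemma continuous_circle_bounded (R : realType) (h : R -> R) :
  continuous h -> invariant_fun eq_angle h ->
  exists2 H : R, 0 < H & forall u, `|h u| <= H.
Proof.
move=> ch ih; have p0 : 0 <= 2 * pi :> R by rewrite mulr_ge0// pi_ge0.
have ch' : {within `[0, 2 * pi], continuous (fun x => `|h x|)}.
  apply: continuous_subspaceT => x.
  exact: (cvg_comp _ _ (ch x) (@norm_continuous _ R (h x))).
have [c _ hmax] := EVT_max p0 ch'.
(* Adding 1 keeps the bound positive even when [h] vanishes. *)
exists (`|h c| + 1); first by rewrite ltr_wpDl.
move=> u; have [v /ih -> vI] := eq_angle_segment u.
by rewrite (le_trans (hmax v _))// ?in_itv// lerDl.
Qed.

(** * A neighbourhood of a uniformly distributed state *)

Lemma uniform_states_neq0 (R : realType) (N : nat) :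
  (@uniform_states R N) !=set0.
Proof.
exists (\row_j (2 * pi * (j.+1)%:R / N%:R)), (perm_one _), 0 => j.
by rewrite permE mxE addr0; apply: eq_angle_refl.
Qed.

(** M_- lies in the open disc; compactness of the psi-circle alone makes the bound
    strict and uniform near one uniform state. *)
Lemma M_minus_uniform_near (R : realType) (N : nat) (delta beta sigma : R)
    (U W : set 'rV[R]_N) (g : R * 'rV[R]_N -> R * R) (th : 'rV[R]_N) :
  is_M_minus delta beta sigma U g -> boundary_nbhd U W -> uniform_states th ->
  exists2 rho : R, 0 <= rho < 1 &
    \forall th' \near th, [/\ U th', ~ W th' & forall psi,
      modC (toC (ofC (alpha_I delta beta sigma) + g (psi, th'))) <= rho].
Proof.
move=> [[Uo Uinv Uunif] g1 ginv [MQ _]] [_ _ _ Wunif] th_unif.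
have Uth := Uunif _ th_unif.
pose c (b : R * 'rV[R]_N) :=
  modC (toC (ofC (alpha_I delta beta sigma) + g b)).
have cc psi : {for (psi, th), continuous c}.
  apply: (@continuous_comp _ _ _ (fun b => ofC (alpha_I delta beta sigma) + g b)
    (fun a => modC (toC a))); last exact: modC_continuous.
  apply: continuousD; first exact: cst_continuous.
  by apply: differentiable_continuous; have [] := g1 (psi, th) Uth.
(* A NAIM lies in its phase space, here the open disc; hub phase 0 completes [(psi, th)] to a point
   of M_-. *)
have c1 psi : c (psi, th) < 1.
  exact: (MQ (0, (ofC (alpha_I delta beta sigma) + g (psi, th), (psi, th)))).
have cs : {within `[0, 2 * pi], continuous (fun psi => c (psi, th))}.
  apply: continuous_subspaceT => psi.
  apply: (@continuous_comp _ _ _ (fun psi : R => (psi, th)) c); last exact: cc.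
  exact: (@cvg_pair _ _ _ (nbhs psi) (nbhs psi) (nbhs th) _ _ _ id (cst th)
    cvg_id (cvg_cst _)).
have p0 : 0 <= 2 * pi :> R by rewrite mulr_ge0// pi_ge0.
have [psi0 _ cmax] := EVT_max p0 cs.
have c00 : 0 <= c (psi0, th) by apply: modC_ge0.
(* Halfway between the maximum over the psi-circle and 1, leaving a gap for nearby [th']. *)
exists ((c (psi0, th) + 1) / 2); first by have := c1 psi0; lra.
have ncov := (compact_near_coveringP _).1 (@segment_compact R 0 (2 * pi)).
have c_near : \forall th' \near th, `[0, 2 * pi]%classic `<=`
    [set psi | c (psi, th') <= (c (psi0, th) + 1) / 2].
  apply: (ncov _ (nbhs th)
    (fun th' psi => c (psi, th') <= (c (psi0, th) + 1) / 2)) => psi psiI.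
  have ltc : c (psi, th) < (c (psi0, th) + 1) / 2.
    by have := cmax psi psiI; have := c1 psi0; lra.
  have H : nbhs (psi, th) [set b | c b < (c (psi0, th) + 1) / 2].
    exact: cvgr_lt _ (cc psi) _ ltc.
  by move: H; apply: filterS => -[x y] /= /ltW.
have Unear : \forall th' \near th, U th' by apply: open_nbhs_nbhs.
(* Uniform states avoid even the closure of [W], whose complement is open. *)
have Wnear : \forall th' \near th, ~ closure W th'.
  apply: open_nbhs_nbhs; split; first exact: closed_openC (@closed_closure _ W).
  by move=> Wth; have : (closure W `&` uniform_states) th by []; rewrite Wunif.
apply: filterS3 Unear Wnear c_near => th' Uth' nWth' cth'; split => //.
  by move=> /(@subset_closure _ W).
move=> psi; have [psi' psiE psi'I] := eq_angle_segment psi.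
rewrite (ginv (psi, th') (psi', th')); first by apply: cth'; rewrite /= in_itv.
by split => //= i; apply: eq_angle_refl.
Qed.

(** [B] and [U1] consist of all translates, modulo 2 pi in each coordinate, of balls of radii [d]
    and [d / 2] about one uniform state. This makes them subsets of the torus, and a displacement
    below [d / 2] leads from [U1] into [B]. *)
Lemma chimera_neighbourhood (R : realType) (N : nat) (delta beta sigma : R)
    (U W : set 'rV[R]_N) (g : R * 'rV[R]_N -> R * R) :
  is_M_minus delta beta sigma U g -> boundary_nbhd U W ->
  exists (B U1 : set 'rV[R]_N) (r rho : R),
    [/\ 0 < r, 0 <= rho < 1,
       [/\ open U1, invariant_set eq_angles U1, U1 !=set0 & U1 `<=` U],
       forall th th', U1 th -> `|th' - th| < r -> B th' &
       forall th, B th -> ~ W th /\ forall psi,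
         modC (toC (ofC (alpha_I delta beta sigma) + g (psi, th))) <= rho].
Proof.
move=> MM bW; have [th0 th0_unif] := @uniform_states_neq0 R N.
have [rho rhoI /nbhs_normP[d d0 Hd]] := M_minus_uniform_near MM bW th0_unif.
have {}d0 : 0 < d := d0.
have [[Uo Uinv _] _ ginv _] := MM; have [_ Winv _ _] := bW.
pose B r := [set th : 'rV[R]_N |
  exists2 th1, eq_angles th th1 & `|th0 - th1| < r].
have r0 : 0 < d / 2 by rewrite divr_gt0.
have Bd th : B d th -> [/\ U th, ~ W th & forall psi,
      modC (toC (ofC (alpha_I delta beta sigma) + g (psi, th))) <= rho].
  move=> [th1 e1 /Hd[U1 nW1 c1]]; split.
  - by apply: Uinv U1 => i; apply: eq_angle_sym.
  - by move=> /Winv => /(_ _ e1).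
  - move=> psi; rewrite (ginv (psi, th) (psi, th1))//.
    by split => //=; apply: eq_angle_refl.
exists (B d), (B (d / 2)), (d / 2), rho; split => //; first split.
- rewrite openE => th [th1 e1 th1r].
  apply/(@nbhs_normP _ _ th).
  exists (d / 2 - `|th0 - th1|); first by rewrite /= subr_gt0.
  move=> th' /= th'r; exists (th1 + (th' - th)).
    move=> i; have [k ek] := e1 i; exists k.
    by rewrite !mxE ek; ring.
  rewrite opprD addrA (le_lt_trans (ler_normB _ _))//.
  by rewrite -ltrBrDl distrC.
- move=> th th' ee [th1 e1 th1r]; exists th1 => // i.
  exact: eq_angle_trans (eq_angle_sym (ee i)) (e1 i).
- exists th0, th0; last by rewrite subrr normr0.
  by move=> i; apply: eq_angle_refl.
- move=> th [th1 e1 th1r]; have [] := Bd th; last by [].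
  by exists th1 => //; rewrite (lt_trans th1r)// ltr_pdivrMr// ltr_pMr// ltr1n.
- move=> th th' [th1 e1 th1r] th'r; exists (th1 + (th' - th)).
    move=> i; have [k ek] := e1 i; exists k.
    by rewrite !mxE ek; ring.
  rewrite opprD addrA (le_lt_trans (ler_normB _ _))//.
  by rewrite [d]splitr ltrD.
- by move=> th /Bd[].
Qed.

(** * From the order of the drift to the time scale *)

(** What the drift estimates use of a point of M_eps: the [+] phases are eps-close to phi^C modulo 2
    pi, and alpha stays in a fixed smaller disc. *)
Definition near_M (R : realType) (N : nat) (delta beta sigma C rho eps : R)
    (x : star_state R N) : Prop :=
  (forall i, exists2 e, eq_angle (phi_p x.1 i) (phi_C delta beta sigma + e) &
     `|e| <= C * eps) /\ modC (toC (alpha x.2)) <= rho.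

(** Common core of both couplings: [n] is the order in eps of the theta velocity on M_eps, 1 in
    general and 2 for Kuramoto--Sakaguchi. *)
Lemma stays_for_of_drift_order (R : realType) (N n : nat)
    (delta beta sigma eta eps0 : R)
    (X : R -> star_state R N -> star_state R N) (d : chimera_data R N) :
  0 < eps0 -> has_chimeras delta beta sigma eta eps0 X d ->
  (forall C rho : R, 0 < C -> 0 <= rho < 1 -> exists2 A, 0 < A &
     forall eps x, 0 < eps -> near_M delta beta sigma C rho eps x ->
       `|theta_of (X eps x)| <= A * eps ^+ n) ->
  exists (U1 : set 'rV[R]_N) (K eps1 : R),
    [/\ [/\ open U1, invariant_set eq_angles U1, U1 !=set0 & U1 `<=` dom d],
        0 < K, 0 < eps1 <= eps0 &
        forall eps, 0 < eps <= eps1 ->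
          stays_for (X eps) (M_of delta beta sigma d eps) U1 (K / eps ^+ n)].
Proof.
move=> eps00 [MM bW [[CC CC0 HCC] [CI CI0 HCI]] chim] drift.
have [B [U1 [r [rho [r0 /andP[rho0 rho1] U1P U1B BP]]]]] :=
  chimera_neighbourhood MM bW.
(* [rho] bounds the modulus of alpha^I + g^I only; the larger radius [(rho + 1) / 2] leaves room for
   the perturbation [tI]. *)
have [|A A0 HA] := drift CC ((rho + 1) / 2) CC0; first by lra.
have [e1 /= e10 He1] : exists2 e1 : R, 0 < e1 & forall e, 0 < e < e1 ->
    C1_norm_le dirs_base (over_base (dom d)) (tC d e) (CC * e) /\
    C1_norm_le dirs_base (over_base (dom d)) (tI d e) (CI * e).
  have : \forall e \near (0 : R)^'+,
      C1_norm_le dirs_base (over_base (dom d)) (tC d e) (CC * e) /\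
      C1_norm_le dirs_base (over_base (dom d)) (tI d e) (CI * e).
    exact: filterI.
  rewrite near_withinE => /(@nbhs_normP _ _ (0 : R))[e1 e10 He1].
  exists e1 => // e /andP[e0 ee1].
  by apply: He1 => //=; rewrite sub0r normrN gtr0_norm.
(* With this [K], the distance [L * T] equals [r / 2], below the barrier radius. *)
exists U1, (r / (2 * A)).
(* [e1 / 2] keeps [eps] strictly in the range of the O(eps) bounds; the last term gives
   [2 * CI * eps <= (1 - rho) / 2]. *)
exists (Num.min eps0 (Num.min (e1 / 2) ((1 - rho) / (4 * CI)))).
split => //.
- by rewrite divr_gt0// mulr_gt0.
- rewrite ge_min lexx /= !lt_min eps00 !divr_gt0 ?mulr_gt0//; lra.
move=> eps /andP[ep]; rewrite !le_min => /and3P[epe0 epe1 epC].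
have [|tC1 tI1] := He1 eps; first by rewrite ep; lra.
have [|_ _ [X' [_ X'X XN]] _] := chim eps; first by rewrite ep.
apply: (stays_for_of_slow_drift (B := B) (r := r) (L := A * eps ^+ n) XN) => //.
- by move=> x Qx /BP[nW _]; apply: X'X.
- move=> x [Ux xC xI] /BP[_ Bx]; apply: HA => //; split.
    move=> i; exists (tC d eps (base_of x) 0 i); first exact: xC.
    have [+ _] := tC1 (base_of x) Ux.
    exact: le_trans (row_coord_le _ _).
  rewrite xI addrA (le_trans (modC_toCD _ _))//.
  have [tIx _] := tI1 (base_of x) Ux.
  apply: le_trans (lerD (Bx (psi x.2)) (lexx _)) _.
  by move: epC tIx; rewrite ler_pdivlMr ?mulr_gt0//; lra.
- rewrite [ltLHS](_ : _ = r / 2) ?ltr_pdivrMr// ?ltr_pMr ?ltr1n//.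
  by field; rewrite !gt_eqF// exprn_gt0.
Qed.

(** The sup norm reduces the claim to single components, so the bound does not grow with [N]. *)
Lemma norm_lifted_theta_le (R : realType) (N : nat) (Y : 'I_N -> R)
    (q : minus_state R N) (rho c : R) :
  modC (toC (alpha q)) <= rho -> rho < 1 -> 0 <= c ->
  (forall j, `|Y j| <= c) ->
  `|\row_j (modC (toC (alpha q) + cexp (psi q + theta q 0 j)) ^+ 2
       / (1 - modC (toC (alpha q)) ^+ 2) * Y j)| <= 4 / (1 - rho ^+ 2) * c.
Proof.
move=> q_rho rho1 c0 Yc.
have W j := lift_weight_bound (psi q + theta q 0 j) q_rho rho1.
have A0 : 0 <= 4 / (1 - rho ^+ 2).
  by have /andP[a b] := lift_weight_bound 0 q_rho rho1; apply: le_trans b.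
apply: row_norm_le => [|j]; first exact: mulr_ge0.
rewrite mxE normrM; have /andP[w0 wA] := W j.
by rewrite ler_pM// ger0_norm.
Qed.

Theorem theorem4p2 (R : realType) (delta : R) (h : R -> R)
    (eta eps0 : R) (N0 : nat) (beta0 : R) (I : set R)
    (delta_range : 0 < delta < pi / 4)
    (h_circle : invariant_fun eq_angle h)
    (h_C1 : C1_on [set: R] h)
    (eta_gt0 : 0 < eta) (eps0_gt0 : 0 < eps0)
    (N0_gt0 : (0 < N0)%N) (beta0_gt0 : 0 < beta0)
    (I_open : open I) (I_neq0 : I !=set0)
    (N : nat) (beta sigma : R)
    (N_gt : (N0 < N)%N) (beta_gt : beta0 < beta) (beta_gt1 : 1 < beta)
    (sigma_I : I sigma) (sigma_gt0 : 0 < sigma) :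
  (forall D : forall N, R -> R -> chimera_data R N,
     chimera_family delta eta eps0 N0 beta0 I
       (fun N beta sigma => @lift_general R N h delta beta sigma) D ->
     exists (U1 : set 'rV[R]_N) (K eps1 : R),
       [/\ [/\ open U1, invariant_set eq_angles U1, U1 !=set0 &
               U1 `<=` dom (D N beta sigma)],
           0 < K, 0 < eps1 <= eps0 &
           forall eps, 0 < eps <= eps1 ->
             stays_for (lift_general h delta beta sigma eps)
               (M_of delta beta sigma (D N beta sigma) eps) U1 (K / eps)])
  /\
  (forall c1 vtheta : R, (forall u, h u = c1 * sin (u + vtheta)) ->
   forall D : forall N, R -> R -> chimera_data R N,
     chimera_family delta eta eps0 N0 beta0 I
       (fun N beta sigma => @lift_KS R N c1 vtheta h delta beta sigma) D ->
     exists (U1 : set 'rV[R]_N) (K eps1 : R),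
       [/\ [/\ open U1, invariant_set eq_angles U1, U1 !=set0 &
               U1 `<=` dom (D N beta sigma)],
           0 < K, 0 < eps1 <= eps0 &
           forall eps, 0 < eps <= eps1 ->
             stays_for (lift_KS c1 vtheta h delta beta sigma eps)
               (M_of delta beta sigma (D N beta sigma) eps) U1 (K / eps ^+ 2)]).

Proof.
have h_cont : continuous h.
  by move=> u; apply: differentiable_continuous; have [] := h_C1 u Logic.I.
split=> [D [chim _]|c1 vtheta hE D [chim _]].
  (* [eps ^+ 1] computes to [eps], which gives the time [K / eps]. *)
  apply: (stays_for_of_drift_order (n := 1) eps0_gt0
    (chim N beta sigma N_gt beta_gt beta_gt1 sigma_I sigma_gt0)).
  have [H H0 hH] := continuous_circle_bounded h_cont h_circle.
  move=> C rho C0 /andP[rho0 rho1]; exists (4 / (1 - rho ^+ 2) * H).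
    by rewrite mulr_gt0// divr_gt0// subr_gt0 expr_lt1.
  move=> eps x ep [_ xrho]; rewrite -[leRHS]mulrA expr1.
  apply: (@norm_lifted_theta_le R N (coupling_m h eps x) x.2) => //.
    by rewrite mulr_ge0// ltW.
  by move=> j; rewrite /coupling_m normrM (gtr0_norm ep) mulrC ler_wpM2r// ltW.
apply: (stays_for_of_drift_order (n := 2) eps0_gt0
  (chim N beta sigma N_gt beta_gt beta_gt1 sigma_I sigma_gt0)).
move=> C rho C0 /andP[rho0 rho1].
(* The added 1 keeps the constant positive when [c1 = 0]. *)
have cC : 0 < (`|c1| + 1) * C by rewrite mulr_gt0// ltr_wpDl.
exists (4 / (1 - rho ^+ 2) * ((`|c1| + 1) * C)).
  by rewrite mulr_gt0// divr_gt0// subr_gt0 expr_lt1.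
move=> eps x ep [xC xrho]; rewrite -[leRHS]mulrA.
(* The Watanabe--Strogatz part has no theta component, so only the remainder of the splitting is
   estimated. *)
apply: (@norm_lifted_theta_le R N (fun j => coupling_m h eps x j -
  eps * h (phi_m x.2 j - phi_C delta beta sigma - Gamma x)) x.2) => //.
  by rewrite mulr_ge0 ?sqr_ge0// ltW.
move=> j; rewrite /coupling_m -mulrBr normrM (gtr0_norm ep).
have [e [k phiE] eC] := xC j.
set pC := phi_C _ _ _ in phiE *.
(* Periodicity of [h] removes the multiple of 2 pi by which the [+] phase differs from [pC + e]. *)
have -> : h (phi_m x.2 j - phi_p x.1 j - Gamma x) =
    h (phi_m x.2 j - pC - e - Gamma x).
  by apply: h_circle; exists (- k); rewrite phiE rmorphN /=; ring.
(* The two sine arguments differ by [- e], of size at most [C * eps]; with the prefactor [eps] this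
   is the second order in eps. *)
rewrite !hE -mulrBr normrM.
apply: (@le_trans _ _ (eps * ((`|c1| + 1) * (C * eps)))); last first.
  by rewrite le_eqVlt; apply/orP; left; apply/eqP; ring.
apply: ler_wpM2l; first exact: ltW.
apply: ler_pM => //; first by rewrite lerDl.
apply: le_trans (ler_sinB _ _) _.
by rewrite [X in `|X|](_ : _ = - e) ?normrN//; ring.
Qed.
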